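(* Let $K=\mathbb{F}_q$ be a finite field with $q\neq 2$. Let $G$ be a connected graph with $s$ edges and let $Y\subset\mathbb{P}^s$ be the set associated with the edges of $G$ (defined in the context). Then $I(Y)$ is a complete intersection if and only if one of the following holds: $G$ is a tree; or $G$ is a unicyclic graph whose unique cycle is odd and $q$ is even.
   Context: Graphs are finite and simple. A graph is unicyclic if it has exactly one cycle. Let $G$ have vertex set $\{y_1,\ldots,y_n\}$ and edges $f_1,\ldots,f_s$ ($s\geq 1$), and let $v_i=e_j+e_k\in\{0,1\}^n$ be the characteristic vector of $f_i=\{y_j,y_k\}$. Put $K^*=K\setminus\{0\}$ and, for $x\in (K^* )^n$, $x^{v_i}=x_1^{v_{i1}}\cdots x_n^{v_{in}}$. Define $Y=\{[(x^{v_1},\ldots,x^{v_s},1)] : x\in (K^* )^n\}\subset\mathbb{P}^{s}$, the projective space over $K$. $S[u]=K[t_1,\ldots,t_s,t_{s+1}]$, $u=t_{s+1}$, is a polynomial ring with the standard grading, and $I(Y)$ is the ideal of $S[u]$ generated by the homogeneous polynomials vanishing on $Y$. $I(Y)$ is called a complete intersection if it can be generated by $s$ homogeneous polynomials of $S[u]$. *)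

(* Defs.v *)
From HB Require Import structures.
From mathcomp Require Import all_boot all_order all_algebra.
From mathcomp Require Import mpoly.

Set Implicit Arguments.
Unset Strict Implicit.
Unset Printing Implicit Defensive.

Import GRing.Theory.
Local Open Scope ring_scope.

Section Graphs.

Record sgraph (V : finType) := SGraph {
  adj :> rel V;
  adj_sym : ssrbool.symmetric adj;
  adj_irrefl : irreflexive adj
}.

Variables (V : finType) (G : sgraph V).

Definition edges : {set {set V}} :=
  [set [set z.1; z.2] | z : V * V & adj G z.1 z.2].

Definition connected_graph : Prop :=
  (0 < #|V|)%N /\ forall x y : V, connect (adj G) x y.

(* A cycle of G, as a subgraph, is determined by its set of edges; in this way
   the closed walks differing by a rotation or a reflection are identified.
   The length of the cycle is #|C|. *)
Definition is_cycle (C : {set {set V}}) : Prop :=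
  exists p : seq V,
    [/\ ucycle (adj G) p, (2 < size p)%N & C = [set [set x; next p x] | x in p]].

Definition is_tree : Prop := connected_graph /\ forall C, ~ is_cycle C.

Definition unicyclic : Prop := exists! C, is_cycle C.

End Graphs.

Section Ideals.

Variable R : comNzRingType.

Definition ideal_gen (A : R -> Prop) (p : R) : Prop :=
  exists (m : nat) (c g : 'I_m -> R),
    (forall i, A (g i)) /\ p = \sum_(i < m) c i * g i.

End Ideals.

(* The points of the projective space P^N over K are the lines of K^(N+1),
   [a] being the line spanned by the nonzero vector a. *)
Section Projective.

Variables (K : fieldType) (N : nat).

Definition is_proj_point (L : {vspace 'rV[K]_N.+1}) : Prop := \dim L = 1%N.

Definition homogeneous (F : {mpoly K[N.+1]}) : Prop :=
  exists d : nat, F \is d.-homog.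

(* The zero vector is excluded, so that a nonzero constant vanishes nowhere. *)
Definition vanishes_at (F : {mpoly K[N.+1]}) (L : {vspace 'rV[K]_N.+1}) : Prop :=
  forall a, a \in L -> a != 0 -> F.@[fun i => a ord0 i] = 0.

Definition vanishing_ideal (X : {vspace 'rV[K]_N.+1} -> Prop) :
    {mpoly K[N.+1]} -> Prop :=
  ideal_gen (fun F => homogeneous F /\ forall L, X L -> vanishes_at F L).

(* Repetitions and zeros are allowed among the N generators. *)
Definition complete_intersection (I : {mpoly K[N.+1]} -> Prop) : Prop :=
  exists g : 'I_N -> {mpoly K[N.+1]},
    (forall i, homogeneous (g i)) /\
    forall p, I p <-> ideal_gen (fun h => exists i, h = g i) p.

End Projective.

Section EdgeSet.

Variables (K : fieldType) (n s : nat) (f : 'I_s -> {set 'I_n}).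

Definition char_vec (i : 'I_s) (j : 'I_n) : nat := (j \in f i).

Definition edge_monomial (x : 'I_n -> K) (i : 'I_s) : K :=
  \prod_(j < n) x j ^+ char_vec i j.

(* (x^{v_1}, ..., x^{v_s}, 1): the last coordinate corresponds to u. *)
Definition edge_vector (x : 'I_n -> K) : 'rV[K]_s.+1 :=
  \row_k (if unlift ord_max k is Some i then edge_monomial x i else 1).

Definition setY (L : {vspace 'rV[K]_s.+1}) : Prop :=
  exists x : 'I_n -> K, (forall j, x j != 0) /\ L = <[edge_vector x]>%VS.

Lemma setY_proj_point (L : {vspace 'rV[K]_s.+1}) : setY L -> is_proj_point L.
Proof.
move=> [x [_ ->]]; rewrite /is_proj_point dim_vline.
suff -> : edge_vector x != 0 by [].
by apply/eqP => /rowP /(_ ord_max); rewrite !mxE unlift_none => /eqP;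
  rewrite oner_eq0.
Qed.

End EdgeSet.

(* Main.v *)
(* Write p = q - 1 and u = t_{s+1}. The ideal I(Y) is a complete intersection
   iff the edge map x |-> (x^{v_1}, ..., x^{v_s}) maps the torus (K^* )^n onto
   (K^* )^s.

   If it is onto, the generators are the h_i = t_i^p - u^p: modulo them the
   exponents of t_1, ..., t_s can be taken below p, and distinct such monomials
   are distinct, hence independent, characters of the torus.

   Conversely let g_1, ..., g_s be homogeneous generators. No form of degree
   d < p vanishing on Y contains a pure power t_k^d, so comparing the
   coefficients of the t_j^p in h_i = sum_k c_ik g_k gives C Gamma = 1, with
   C = (c_ik(0)) and Gamma = (coefficient of t_j^p in g_k). Hence all g_k have
   degree p and are linear combinations of the h_i, so I(Y) vanishes on the
   whole torus, whereas a product of linear forms separates a point outside the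
   image from Y.

   Surjectivity of the edge map is then decided on the graph: forests are solved
   leaf by leaf; a cycle of even length imposes a relation on the values of its
   edges, one of odd length forces every element of K to be a square, and two
   cycles would allow more values than there are vertex labellings. *)

From Stdlib Require Import Classical_Prop.
Require Import Defs.
From HB Require Import structures.
From mathcomp Require Import all_boot all_order all_algebra.
From mathcomp Require Import finfield mpoly.

Set Implicit Arguments.
Unset Strict Implicit.
Unset Printing Implicit Defensive.

(** * Power sums and independence of characters over a finite field *)

Section Characters.

Import GRing.Theory.
Local Open Scope ring_scope.

Variable K : finFieldType.

Lemma expf_card_pred (x : K) : x != 0 -> x ^+ #|K|.-1 = 1.
Proof.
move=> x0; apply: (mulfI x0).
by rewrite -exprS prednK ?(ltnW (finNzRing_gt1 K)) // expf_card mulr1.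
Qed.

Lemma card_nonzero : #|[pred x : K | x != 0]| = #|K|.-1.
Proof. by rewrite -(cardC1 (0 : K)); apply: eq_card => x; rewrite !inE. Qed.

Lemma card_finField_pred_gt0 : (0 < #|K|.-1)%N.
Proof. by rewrite -subn1 subn_gt0 finNzRing_gt1. Qed.

(** Translation by 1 permutes [K], so adding 1 to each of the [#|K|] terms leaves the sum of all
    elements unchanged. *)
Lemma natr_card_finField : #|K|%:R = 0 :> K.
Proof.
have /esym/eqP : \sum_(x : K) (x + 1) = \sum_(x : K) x.
  by rewrite [RHS](reindex_inj (addIr 1)).
by rewrite big_split /= sumr_const addrC -subr_eq subrr eq_sym => /eqP.
Qed.

Lemma natr_card_nonzero : #|K|.-1%:R != 0 :> K.
Proof.
have := natr_card_finField.
rewrite -{1}(prednK (ltnW (finNzRing_gt1 K))) -natr1 => /eqP.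
by rewrite addr_eq0 => /eqP ->; rewrite oppr_eq0 oner_eq0.
Qed.

(** Otherwise all q - 1 nonzero elements would be roots of X^r - 1, where r is the remainder of [e]
    modulo q - 1 and 0 < r < q - 1. *)
Lemma exists_exp_neq1 (e : nat) :
  ~~ (#|K|.-1 %| e)%N -> exists2 b : K, b != 0 & b ^+ e != 1.
Proof.
move=> ndvd; set r := (e %% #|K|.-1)%N.
have r_gt0 : (0 < r)%N by rewrite lt0n.
have r_lt : (r < #|K|.-1)%N by rewrite ltn_mod card_finField_pred_gt0.
have [/existsP [b /andP [b0 br]] | /existsPn h] :=
    boolP [exists b : K, (b != 0) && (b ^+ r != 1)].
  exists b => //; apply: contraNneq br => be.
  rewrite (divn_eq e #|K|.-1) exprD mulnC exprM (expf_card_pred b0) expr1n in be.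
  by rewrite mul1r in be; rewrite be.
suff : (#|K|.-1 <= r)%N by rewrite leqNgt r_lt.
rewrite -card_nonzero cardE.
apply: max_unity_roots => //; last exact: enum_uniq.
apply/allP => x; rewrite mem_enum inE => x0; apply/unity_rootP.
by have := h x; rewrite x0 /= negbK => /eqP.
Qed.

(** Scaling by some b with b^e different from 1 permutes the nonzero elements and multiplies the sum
    by b^e, so the sum is 0 unless every term is 1. *)
Lemma sum_expf_nonzero (e : nat) :
  \sum_(a : K | a != 0) a ^+ e = #|K|.-1%:R *+ (#|K|.-1 %| e)%N.
Proof.
have [/dvdnP [k ->] | ndvd] := boolP (_ %| _)%N.
  rewrite (eq_bigr (fun=> 1)) => [|a a0].
    by rewrite sumr_const card_nonzero.
  by rewrite mulnC exprM expf_card_pred // expr1n.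
have [b b0 be] := exists_exp_neq1 ndvd.
set S := \sum_(_ | _) _; suff : (b ^+ e - 1) * S = 0.
  by move/eqP; rewrite mulf_eq0 subr_eq0 (negbTE be) => /eqP.
apply/eqP; rewrite mulrBl mul1r subr_eq0 mulr_sumr; apply/eqP.
rewrite [RHS](reindex_inj (mulfI b0)) /=; apply: eq_big => a.
  by rewrite mulf_eq0 negb_or b0.
by rewrite exprMn.
Qed.

(** Independence of the characters of the torus: exponents congruent modulo q - 1 give the same
    character, whose total coefficient is isolated by summing against the inverse character. *)
Lemma sum_characters_eq0 (n : nat) (T : Type) (r : seq T) (c : T -> K)
    (E : T -> 'I_n -> nat) :
  (forall a : 'I_n -> K, (forall i, a i != 0) ->
     \sum_(t <- r) c t * \prod_i a i ^+ E t i = 0) ->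
  forall e : 'I_n -> nat,
  \sum_(t <- r | [forall i, E t i == e i %[mod #|K|.-1]]) c t = 0.
Proof.
move=> vanish e; set m := #|K|.-1.
pose fam := family (fun i : 'I_n => [pred a : K | a != 0]).
(* Modulo m this is - e i, so the power with exponents [w] is the inverse character, without
   negative exponents. *)
pose w := fun i : 'I_n => (e i * m.-1)%N.
have key : \sum_(a in fam)
    (\sum_(t <- r) c t * \prod_i a i ^+ E t i) * \prod_i a i ^+ w i = 0.
  by apply: big1 => a /familyP ha; rewrite vanish ?mul0r.
(* The factor m^n can be cancelled because m = q - 1 equals -1 in [K]. *)
suff : \sum_(a in fam) (\sum_(t <- r) c t * \prod_i a i ^+ E t i)
       * \prod_i a i ^+ w i =
    (m%:R ^+ n) * \sum_(t <- r | [forall i, E t i == e i %[mod m]]) c t.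
  rewrite key => /esym/eqP; rewrite mulf_eq0 expf_eq0 (negbTE natr_card_nonzero).
  by rewrite andbF => /eqP.
under eq_bigr do rewrite mulr_suml.
rewrite exchange_big /= mulr_sumr [RHS]big_mkcond /=; apply: eq_bigr => t _.
have -> : \sum_(a in fam) c t * \prod_i a i ^+ E t i * \prod_i a i ^+ w i =
    c t * \prod_i (m%:R *+ (E t i == e i %[mod m])).
  under [LHS]eq_bigr do rewrite -mulrA -big_split /=.
  rewrite -mulr_sumr; congr (_ * _).
  transitivity (\prod_(i < n) \sum_(a : K | a != 0) a ^+ (E t i + w i)).
    rewrite (bigA_distr_big_dep (fun _ (a : K) => a != 0)) /=.
    by apply: eq_bigr => a _; apply: eq_bigr => i _; rewrite exprD.
  apply: eq_bigr => i _; rewrite sum_expf_nonzero -/m.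
  congr (_ *+ nat_of_bool _).
  have m_gt0 : (0 < m)%N := card_finField_pred_gt0.
  rewrite -[RHS](eqn_modDr (w i)) /w -{3}[e i]muln1 -mulnDr add1n prednK //.
  by rewrite modnMl.
case: ifP => [/forallP h | /forallPn [i hi]].
  rewrite (eq_bigr (fun=> m%:R)) => [|i _]; last by rewrite h.
  by rewrite prodr_const card_ord mulrC.
by rewrite (bigD1 i) //= (negbTE hi) mul0r mulr0.
Qed.

End Characters.

(** * Finitely generated ideals, homogeneous evaluation, coefficients of products *)

Section PolynomialIdeals.

Import GRing.Theory.
Local Open Scope ring_scope.

Lemma ideal_gen_famP (R : comNzRingType) (N : nat) (g : 'I_N -> R) (p : R) :
  ideal_gen (fun h => exists i, h = g i) p <->
  exists c : 'I_N -> R, p = \sum_i c i * g i.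
Proof.
split=> [[m [c [h [hg ->]]]] | [c ->]]; last first.
  by exists N, c, g; split=> // i; exists i.
have [j hj] := fin_all_exists hg.
exists (fun k => \sum_(i | j i == k) c i).
under [RHS]eq_bigr do rewrite mulr_suml.
rewrite (partition_big j predT) //=; apply: eq_bigr => k _.
by apply: eq_bigr => i /eqP <-; rewrite hj.
Qed.

Lemma ideal_gen_sub (R : comNzRingType) (N : nat) (A : R -> Prop)
    (g : 'I_N -> R) :
  (forall p, A p -> exists c : 'I_N -> R, p = \sum_i c i * g i) ->
  forall p, ideal_gen A p -> exists c : 'I_N -> R, p = \sum_i c i * g i.
Proof.
move=> hA p [m [c [h [hh ->]]]].
have [d hd] := fin_all_exists (fun i => hA _ (hh i)).
exists (fun k => \sum_i c i * d i k).
under [RHS]eq_bigr do rewrite mulr_suml.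
rewrite exchange_big /=; apply: eq_bigr => i _.
by rewrite hd mulr_sumr; apply: eq_bigr => k _; rewrite mulrA.
Qed.

Lemma ideal_gen1 (R : comNzRingType) (A : R -> Prop) (p : R) :
  A p -> ideal_gen A p.
Proof.
by move=> Ap; exists 1%N, (fun=> 1), (fun=> p); rewrite big_ord1 mul1r.
Qed.

Lemma meval_dhomog_scale (R : comNzRingType) (n d : nat) (F : {mpoly R[n]})
    (c : R) (v : 'I_n -> R) :
  F \is d.-homog -> F.@[fun i => c * v i] = c ^+ d * F.@[v].
Proof.
move=> hF; rewrite !mevalE mulr_sumr big_seq [RHS]big_seq.
apply: eq_bigr => m mF; rewrite mulrCA; congr (_ * _).
have <- : mdeg m = d := dhomog_mf hF mF.
rewrite mdegE -prodrXr -big_split /=.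
by apply: eq_bigr => i _; rewrite exprMn.
Qed.

Lemma vanishes_at_vline (K : fieldType) (N d : nat) (F : {mpoly K[N.+1]})
    (a : 'rV[K]_N.+1) :
  F \is d.-homog -> a != 0 ->
  vanishes_at F <[a]>%VS <-> F.@[fun i => a ord0 i] = 0.
Proof.
move=> hF a0; split=> [|Fa b /vlineP [c ->] _]; first by apply; rewrite ?memv_line.
rewrite (meval_eq (v2 := fun i => c * a ord0 i)) => [|i]; last by rewrite mxE.
by rewrite (meval_dhomog_scale _ _ hF) Fa mulr0.
Qed.

(** If [g] has no term at a proper divisor of [m], only the splitting m = 0 + m survives in the
    convolution. This is what reduces polynomial coefficients to their constant terms. *)
Lemma mcoeffM_minimal (R : comNzRingType) (n : nat) (c g : {mpoly R[n]})
    (m : 'X_{1..n}) :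
  (forall m1 m2, m = (m1 + m2)%MM -> m1 != 0%MM -> g@_m2 = 0) ->
  (c * g)@_m = c@_0%MM * g@_m.
Proof.
move=> hg; rewrite mcoeffM.
have lt0 : (mdeg (0%MM : 'X_{1..n}) < (mdeg m).+1)%N by rewrite mdeg0.
rewrite (bigD1 (BMultinom lt0, BMultinom (ltnSn (mdeg m)))) /= ?add0m //.
rewrite big1 ?addr0 // => -[m1 m2] /= /andP [/eqP e ne].
rewrite (hg m1 m2) ?mulr0 //; apply: contra ne => /eqP m10.
apply/eqP; congr (_, _); apply: val_inj => //=.
by move: e; rewrite m10 add0m.
Qed.

End PolynomialIdeals.

(** * Vanishing on Y, and forms of degree below p *)

Section EdgeTorus.

Import GRing.Theory.
Local Open Scope ring_scope.

Variables (K : finFieldType) (n s : nat) (f : 'I_s -> {set 'I_n}).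
Hypothesis f_inj : injective f.
Hypothesis f_nonempty : forall i, f i != set0.

Local Notation p := (#|K|.-1).
Local Notation u := (@ord_max s).

Definition covers_torus : Prop :=
  forall y : 'I_s -> K, (forall i, y i != 0) ->
  exists2 x : 'I_n -> K, (forall j, x j != 0) & forall i, edge_monomial f x i = y i.

(** The coordinate u gets the zero exponent vector, so that all s + 1 coordinates of a point of Y
    are monomials in x. *)
Definition homog_char_vec (k : 'I_s.+1) (j : 'I_n) : nat :=
  if unlift u k is Some i then char_vec f i j else 0.

Lemma homog_char_vec_inj (k l : 'I_s.+1) :
  homog_char_vec k =1 homog_char_vec l -> k = l.
Proof.
rewrite /homog_char_vec /char_vec.
case: unliftP => [i ->|->]; case: unliftP => [i' ->|->] // h.
- congr lift; apply: f_inj; apply/setP => j.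
  by move: (h j); do 2!case: (_ \in _).
- have /set0Pn [j ji] := f_nonempty i.
  by move: (h j); rewrite ji.
- have /set0Pn [j ji] := f_nonempty i'.
  by move: (h j); rewrite ji.
Qed.

Lemma homog_char_vec_le1 k j : (homog_char_vec k j <= 1)%N.
Proof.
by rewrite /homog_char_vec; case: unlift => // i; rewrite /char_vec leq_b1.
Qed.

Lemma edge_vectorE (x : 'I_n -> K) (k : 'I_s.+1) :
  edge_vector f x ord0 k = \prod_j x j ^+ homog_char_vec k j.
Proof.
rewrite mxE /homog_char_vec; case: unlift => [i|] //.
by rewrite big1 // => j _; rewrite expr0.
Qed.

Lemma edge_vector_neq0 (x : 'I_n -> K) : edge_vector f x != 0.
Proof.
apply/eqP => /rowP /(_ u); rewrite !mxE unlift_none => /eqP.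
by rewrite oner_eq0.
Qed.

(** The representative with u = 1, for any y in the torus and not only for images of the edge
    map. *)
Definition point (y : 'I_s -> K) (k : 'I_s.+1) : K :=
  if unlift u k is Some i then y i else 1.

Lemma vanishing_on_setY (F : {mpoly K[s.+1]}) (d : nat) :
  F \is d.-homog ->
  (forall L, setY f L -> vanishes_at F L) <->
  forall x : 'I_n -> K, (forall j, x j != 0) ->
    F.@[point (edge_monomial f x)] = 0.
Proof.
move=> hF; have E x := vanishes_at_vline hF (edge_vector_neq0 x).
have P x : F.@[point (edge_monomial f x)] = F.@[fun i => edge_vector f x ord0 i].
  by apply: meval_eq => k; rewrite mxE.
split=> [h x x0 | h L [x [x0 ->]]].
  by rewrite P; apply/E/h; exists x.
by apply/E; rewrite -P h.
Qed.

Lemma mem_vanishing_ideal (F : {mpoly K[s.+1]}) (d : nat) :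
  F \is d.-homog ->
  (forall x : 'I_n -> K, (forall j, x j != 0) ->
    F.@[point (edge_monomial f x)] = 0) ->
  vanishing_ideal (setY f) F.
Proof.
move=> hF h; apply: ideal_gen1; split; first by exists d.
exact/(vanishing_on_setY hF).
Qed.

Lemma vanishing_ideal_eval (F : {mpoly K[s.+1]}) :
  vanishing_ideal (setY f) F ->
  forall x : 'I_n -> K, (forall j, x j != 0) ->
    F.@[point (edge_monomial f x)] = 0.
Proof.
move=> [m [c [g [hg ->]]]] x x0; rewrite raddf_sum big1 // => i _.
have [[d hd] /(vanishing_on_setY hd) hi] := hg i.
by rewrite /= mevalM hi ?mulr0.
Qed.

(* A monomial of degree d < p restricts to Y as a character whose exponents are
   at most d, so no reduction modulo p takes place; only t_k^d restricts to the
   character of t_k^d, because the v_i are distinct nonzero 0/1 vectors. *)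
Lemma pure_power_mcoeff_eq0 (F : {mpoly K[s.+1]}) (d : nat) (k : 'I_s.+1) :
  F \is d.-homog -> (d < p)%N ->
  (forall x : 'I_n -> K, (forall j, x j != 0) ->
    F.@[point (edge_monomial f x)] = 0) ->
  F@_(U_(k) *+ d) = 0.
Proof.
move=> hF d_lt vanish.
(* Exponent of x_j after substituting the coordinates of Y into t^m. *)
pose E (m : 'X_{1..s.+1}) (j : 'I_n) := (\sum_l homog_char_vec l j * m l)%N.
have vanish' a : (forall j, a j != 0) ->
    \sum_(m <- msupp F) F@_m * \prod_j a j ^+ E m j = 0.
  move=> a0; rewrite -[RHS](vanish a a0) mevalE; apply: eq_bigr => m _.
  congr (_ * _).
  transitivity (\prod_l \prod_j (a j ^+ homog_char_vec l j) ^+ m l).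
    rewrite exchange_big /=; apply: eq_bigr => j _; rewrite -prodrXr.
    by apply: eq_bigr => l _; rewrite exprM.
  apply: eq_bigr => l _; rewrite prodrXl; congr (_ ^+ _).
  by rewrite -edge_vectorE mxE.
have := sum_characters_eq0 vanish' (fun j => homog_char_vec k j * d)%N.
have -> : \sum_(m <- msupp F | [forall i, E m i == homog_char_vec k i * d
            %[mod p]]) F@_m = F@_(U_(k) *+ d).
  rewrite big_seq_cond (eq_bigl (fun m => (m \in msupp F) && (m == (U_(k) *+ d)%MM))).
    rewrite -big_seq_cond; have [hin | hnin] := boolP ((U_(k) *+ d)%MM \in msupp F).
      rewrite -big_filter (_ : filter _ _ = [:: (U_(k) *+ d)%MM]) ?big_seq1 //.
      by rewrite (filter_pred1_uniq (msupp_uniq F)).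
    rewrite memN_msupp_eq0 // big_seq_cond big1 // => m /andP [hm /eqP em].
    by rewrite -em hm in hnin.
  move=> m /=; have [mF /= | //] := boolP (m \in msupp F).
  have degm : mdeg m = d := dhomog_mf hF mF.
  apply/forallP/eqP => [h | -> j]; last first.
    rewrite /E (bigD1 k) //= big1 ?addn0 => [|l lk].
      by rewrite mulmnE mnm1E eqxx mul1n.
    by rewrite mulmnE mnm1E eq_sym (negbTE lk) mul0n muln0.
  have EE j : E m j = (homog_char_vec k j * d)%N.
    have lt1 : (E m j < p)%N.
      apply: leq_ltn_trans d_lt; rewrite -degm mdegE; apply: leq_sum => l _.
      by rewrite -{2}(mul1n (m l)) leq_mul2r homog_char_vec_le1 orbT.
    have lt2 : (homog_char_vec k j * d < p)%N.
      apply: leq_ltn_trans d_lt.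
      by rewrite -{2}(mul1n d) leq_mul2r homog_char_vec_le1 orbT.
    by have /eqP := h j; rewrite !modn_small.
  (* If t_l occurs in t^m, then v_l = v_k: where v_k is 1 and v_l is 0, the exponent of x_j would
     fall short of d; where v_k is 0 and v_l is 1, it would be positive instead of 0. *)
  have supp l : l != k -> m l = 0%N.
    apply: contraNeq => ml; apply/eqP; apply: homog_char_vec_inj => j.
    have := EE j; have := homog_char_vec_le1 k j; have := homog_char_vec_le1 l j.
    case el : (homog_char_vec l j) => [|[|//]] _;
    case ek : (homog_char_vec k j) => [|[|//]] _ //.
      rewrite mul1n -degm mdegE /E => /eqP.
      rewrite eqn_leq => /andP [_]; rewrite leqNgt => /negP; case.
      rewrite [X in (X < _)%N](bigD1 l) //= el mul0n add0n.
      rewrite [X in (_ < X)%N](bigD1 l) //= -[X in (X < _)%N]add0n -addSn.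
      apply: leq_add; first by rewrite lt0n.
      apply: leq_sum => i _.
      by rewrite -{2}(mul1n (m i)) leq_mul2r homog_char_vec_le1 orbT.
    rewrite mul0n /E (bigD1 l) //= el mul1n => /eqP.
    by rewrite addn_eq0 (negbTE ml).
  apply/mnmP => l; rewrite mulmnE mnm1E eq_sym.
  have [-> | lk] := eqVneq l k; last by rewrite supp.
  rewrite mul1n -degm mdegE (bigD1 k) //= big1 ?addn0 //.
by [].
Qed.

(** * The forms t_i^p - u^p; a complete intersection forces surjectivity *)

Definition torus_gen (i : 'I_s) : {mpoly K[s.+1]} :=
  'X_(lift u i) ^+ p - 'X_u ^+ p.

Lemma torus_gen_homog i : torus_gen i \is p.-homog.
Proof.
have hX k : ('X_k : {mpoly K[s.+1]}) ^+ p \is p.-homog.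
  by rewrite -{2}(mul1n p); apply: dhomogMn; rewrite dhomogX /= mdeg1.
by apply: rpredB.
Qed.

Lemma point_lift (y : 'I_s -> K) i : point y (lift u i) = y i.
Proof. by rewrite /point liftK. Qed.

Lemma point_max (y : 'I_s -> K) : point y u = 1.
Proof. by rewrite /point unlift_none. Qed.

Lemma torus_gen_eval (y : 'I_s -> K) i :
  y i != 0 -> (torus_gen i).@[point y] = 0.
Proof.
move=> yi; rewrite mevalB !rmorphXn /= !mevalXU point_lift point_max.
by rewrite expf_card_pred // expr1n subrr.
Qed.

Lemma edge_monomial_neq0 (x : 'I_n -> K) i :
  (forall j, x j != 0) -> edge_monomial f x i != 0.
Proof. by move=> x0; rewrite prodf_seq_neq0; apply/allP => j _; rewrite expf_neq0. Qed.

Lemma torus_gen_mcoeff i j : (torus_gen i)@_(U_(lift u j) *+ p) = (i == j)%:R.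
Proof.
have E k l : ('X_k ^+ p : {mpoly K[s.+1]})@_(U_(l) *+ p) = (k == l)%:R.
  rewrite mcoeffXn; congr (_%:R); congr nat_of_bool.
  apply/eqP/eqP => [/mnmP /(_ k) | -> //].
  rewrite !mulmnE !mnm1E eqxx mul1n [l == k]eq_sym; case: eqP => //= _.
  by have := card_finField_pred_gt0 K; rewrite mul0n => /[swap] ->.
rewrite mcoeffB !E (inj_eq lift_inj).
by rewrite (negbTE (neq_lift _ _)) subr0.
Qed.

(** For each of the finitely many x, take the linear form t_i - x^{v_i} u at a coordinate i where
    the image of x differs from y, and multiply these forms. *)
Lemma separating_form (y : 'I_s -> K) :
  (forall x : 'I_n -> K, (forall j, x j != 0) ->
     exists i, edge_monomial f x i != y i) ->
  exists F : {mpoly K[s.+1]},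
    [/\ homogeneous F,
        forall x : 'I_n -> K, (forall j, x j != 0) ->
          F.@[point (edge_monomial f x)] = 0
      & F.@[point y] != 0].
Proof.
move=> hy.
pose L (x : {ffun 'I_n -> K}) (i : 'I_s) : {mpoly K[s.+1]} :=
  'X_(lift u i) - edge_monomial f x i *: 'X_u.
have L_homog x i : L x i \is 1.-homog.
  by apply: rpredB; [| apply: rpredZ]; rewrite dhomogX /= mdeg1.
have L_eval x i z : (L x i).@[point z] = z i - edge_monomial f x i.
  by rewrite mevalB mevalZ !mevalXU point_lift point_max mulr1.
pose F := \prod_(x : {ffun 'I_n -> K} | [forall j, x j != 0])
  if [pick i | edge_monomial f x i != y i] is Some i then L x i else 1.
exists F; split.
- apply: (big_ind (@homogeneous K s)).
  + by exists 0%N; apply: dhomog1.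
  + by move=> A B [d hA] [e hB]; exists (d + e)%N; apply: dhomogM.
  + move=> x _; case: pickP => [i _ | _]; first by exists 1%N.
    by exists 0%N; apply: dhomog1.
- move=> x x0; rewrite rmorph_prod (bigD1 [ffun j => x j]) /=; last first.
    by apply/forallP => j; rewrite ffunE.
  have E i : edge_monomial f [ffun j => x j] i = edge_monomial f x i.
    by apply: eq_bigr => j _; rewrite ffunE.
  case: pickP => [i _ | no]; first by rewrite L_eval E subrr mul0r.
  by have [i] := hy _ x0; rewrite -E no.
- rewrite rmorph_prod /=; apply/prodf_neq0 => x /forallP x0.
  case: pickP => [i | no]; first by rewrite L_eval subr_eq0 eq_sym.
  by have [i] := hy _ x0; rewrite no.
Qed.

Lemma complete_intersection_covers_torus :
  complete_intersection (vanishing_ideal (@setY K n s f)) -> covers_torus.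
Proof.
move=> [g [g_homog gI]].
have gI' k : vanishing_ideal (setY f) (g k).
  by apply/gI/ideal_gen1; exists k.
have g0 k := vanishing_ideal_eval (gI' k).
have [e g_deg] := fin_all_exists g_homog.
have hI i : exists c : 'I_s -> {mpoly K[s.+1]}, torus_gen i = \sum_k c k * g k.
  apply/ideal_gen_famP/gI/(mem_vanishing_ideal (torus_gen_homog i)) => x x0.
  exact/torus_gen_eval/edge_monomial_neq0.
have [c hc] := fin_all_exists hI.
pose C := \matrix_(i, k) (c i k)@_0%MM.
pose Gam := \matrix_(k, j) (g k)@_(U_(lift u j) *+ p)%MM.
have CG : C *m Gam = 1%:M.
  apply/matrixP => i j; rewrite !mxE -torus_gen_mcoeff hc raddf_sum /=.
  (* A proper divisor of t_l^p is a smaller power of t_l. Its coefficient in g_k vanishes by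
     [pure_power_mcoeff_eq0] if g_k has that degree, and by homogeneity otherwise. *)
  apply: eq_bigr => k _; rewrite !mxE mcoeffM_minimal // => m1 m2 em m1n0.
  set l := lift u j in em *.
  have em2 : m2 = (U_(l) *+ m2 l)%MM.
    apply/mnmP => i'; rewrite mulmnE mnm1E; case: eqP => [-> | li'].
      by rewrite mul1n.
    move/mnmP: em => /(_ i'); rewrite mulmnE mnm1E mnmDE.
    by move/eqP: li' => /negbTE -> /esym /eqP; rewrite addn_eq0 => /andP [_ /eqP].
  have lt_m2 : (m2 l < p)%N.
    have : mdeg (U_(l) *+ p)%MM = mdeg (m1 + m2)%MM by rewrite em.
    rewrite mdegMn mdeg1 mul1n mdegD {1}em2 mdegMn mdeg1 mul1n => ->.
    by rewrite -[X in (X < _)%N]add0n ltn_add2r lt0n mdeg_eq0.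
  rewrite em2; have [ek | ek] := eqVneq (e k) (m2 l).
    by apply: pure_power_mcoeff_eq0 (g0 k); rewrite -ek // ek.
  apply: (dhomog_nemf_coeff (g_deg k)).
  by rewrite /= mdegMn mdeg1 mul1n eq_sym.
have GC := mulmx1C CG.
(* If g_k had another degree, row k of [Gam] would be zero, against [Gam *m C = 1]. *)
have {}g_deg k : g k \is p.-homog.
  suff -> : p = e k by [].
  apply/eqP; apply: contraT => ne.
  have /eqP := congr1 (fun M : 'M_s => M k k) GC.
  rewrite !mxE eqxx big1 ?(eq_sym 0) ?oner_eq0 // => j _.
  rewrite !mxE (dhomog_nemf_coeff (g_deg k)) ?mul0r //.
  by rewrite /= mdegMn mdeg1 mul1n.
(* Both sides are forms of degree p, and in that degree only the constant terms of the c_ik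
   contribute. *)
have hE i : torus_gen i = \sum_k C i k *: g k.
  apply/mpolyP => m; have [em | nm] := eqVneq (mdeg m) p; last first.
    rewrite !(dhomog_nemf_coeff _ nm) ?torus_gen_homog //.
    by apply: rpred_sum => k _; apply: rpredZ.
  rewrite hc !raddf_sum /=; apply: eq_bigr => k _.
  rewrite mcoeffZ mxE mcoeffM_minimal // => m1 m2 mE m1n0.
  apply: (dhomog_nemf_coeff (g_deg k)); rewrite /= -em mE mdegD.
  by rewrite -[X in X != _]add0n eqn_add2r eq_sym mdeg_eq0.
have gE k : g k = \sum_i Gam k i *: torus_gen i.
  under eq_bigr do rewrite hE scaler_sumr.
  rewrite exchange_big /=.
  transitivity (\sum_l (Gam *m C) k l *: g l).
    rewrite GC (bigD1 k) //= mxE eqxx scale1r big1 ?addr0 // => l lk.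
    by rewrite mxE eq_sym (negbTE lk) scale0r.
  apply: eq_bigr => l _; rewrite mxE scaler_suml.
  by apply: eq_bigr => i _; rewrite scalerA.
move=> y y0.
pose covered := [exists x : {ffun 'I_n -> K}, [forall j, x j != 0] &&
  [forall i, edge_monomial f x i == y i]].
have [/existsP [x /andP [/forallP x0 /forallP xy]] | /existsPn ncov] :=
    boolP covered.
  by exists x => // i; apply/eqP.
have [|F [[d hF] F0 Fy]] := @separating_form y.
  move=> x x0; have := ncov [ffun j => x j]; rewrite negb_and.
  case/orP => [/forallPn [j] | /forallPn [i hi]].
    by rewrite ffunE x0.
  exists i; apply: contra hi => /eqP <-; apply/eqP.
  by apply: eq_bigr => j _; rewrite ffunE.
have /gI/ideal_gen_famP [b Fb] := mem_vanishing_ideal hF F0.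
case/eqP: Fy; rewrite Fb raddf_sum big1 //= => k _.
rewrite mevalM gE raddf_sum big1 ?mulr0 //= => i _.
by rewrite mevalZ torus_gen_eval ?mulr0.
Qed.

(** * Reduction modulo the forms t_i^p - u^p; surjectivity gives a complete intersection *)

Lemma big_lift_max (R : Type) (idx : R) (op : Monoid.law idx)
    (G : 'I_s.+1 -> R) :
  \big[op/idx]_k G k = op (\big[op/idx]_i G (lift u i)) (G u).
Proof.
rewrite big_ord_recr; congr (op _ _); apply: eq_bigr => i _; congr G.
by apply: val_inj; rewrite /= /bump leqNgt ltn_ord.
Qed.

Definition in_torus_ideal (F : {mpoly K[s.+1]}) : Prop :=
  exists c : 'I_s -> {mpoly K[s.+1]}, F = \sum_i c i * torus_gen i.

Lemma in_torus_ideal0 : in_torus_ideal 0.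
Proof. by exists (fun=> 0); rewrite big1 // => i _; rewrite mul0r. Qed.

Lemma in_torus_idealD F F' :
  in_torus_ideal F -> in_torus_ideal F' -> in_torus_ideal (F + F').
Proof.
move=> [c ->] [c' ->]; exists (fun i => c i + c' i).
by rewrite -big_split; apply: eq_bigr => i _; rewrite mulrDl.
Qed.

Lemma in_torus_idealM F F' : in_torus_ideal F -> in_torus_ideal (F' * F).
Proof.
move=> [c ->]; exists (fun i => F' * c i).
by rewrite mulr_sumr; apply: eq_bigr => i _; rewrite mulrA.
Qed.

(** Congruences modulo the ideal multiply, by exchanging one factor at a time. *)
Lemma in_torus_ideal_prod (I : Type) (r : seq I) (A B : I -> {mpoly K[s.+1]}) :
  (forall i, in_torus_ideal (A i - B i)) ->
  in_torus_ideal (\prod_(i <- r) A i - \prod_(i <- r) B i).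
Proof.
move=> hAB; elim: r => [|i r IH].
  by rewrite !big_nil subrr; apply: in_torus_ideal0.
rewrite !big_cons.
have -> : A i * \prod_(j <- r) A j - B i * \prod_(j <- r) B j =
    (\prod_(j <- r) A j) * (A i - B i)
    + B i * (\prod_(j <- r) A j - \prod_(j <- r) B j).
  by rewrite !mulrBr addrA ![_ * B i]mulrC ![_ * A i]mulrC subrK.
by apply: in_torus_idealD; apply: in_torus_idealM.
Qed.

Lemma in_torus_ideal_reduce (i : 'I_s) (a : nat) :
  in_torus_ideal ('X_(lift u i) ^+ a -
                  'X_(lift u i) ^+ (a %% p) * 'X_u ^+ (a %/ p * p)).
Proof.
rewrite {1}(divn_eq a p) addnC exprD -mulrBr; apply: in_torus_idealM.
rewrite ![(_ %/ _ * _)%N]mulnC !exprM subrXX mulrC; apply: in_torus_idealM.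
exists (fun k => (k == i)%:R); rewrite (bigD1 i) //= eqxx mul1r.
by rewrite big1 ?addr0 // => k /negbTE ->; rewrite mul0r.
Qed.

Lemma in_torus_ideal_vanishing (F : {mpoly K[s.+1]}) (d : nat) :
  F \is d.-homog ->
  (forall y : 'I_s -> K, (forall i, y i != 0) -> F.@[point y] = 0) ->
  in_torus_ideal F.
Proof.
move=> hF F0; have p_gt0 := card_finField_pred_gt0 K.
pose res (m : 'X_{1..s.+1}) : {ffun 'I_s -> 'I_p} :=
  [ffun i => Ordinal (ltn_pmod (m (lift u i)) p_gt0)].
have resE m i : res m i = (m (lift u i) %% p)%N :> nat by rewrite ffunE.
(* Normal form with reduced exponents r, filled up to degree d by u. The subtraction is not
   truncated when r is the residue of a monomial of [F]. *)
pose M (r : {ffun 'I_s -> 'I_p}) : {mpoly K[s.+1]} :=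
  (\prod_i 'X_(lift u i) ^+ r i) * 'X_u ^+ (d - \sum_i r i).
have redM m : m \in msupp F -> in_torus_ideal ('X_[m] - M (res m)).
  move=> mF; have degm : mdeg m = d := dhomog_mf hF mF.
  have -> : M (res m) = (\prod_i ('X_(lift u i) ^+ (m (lift u i) %% p) *
      'X_u ^+ (m (lift u i) %/ p * p))) * 'X_u ^+ m u.
    rewrite /M big_split /= -mulrA; congr (_ * _).
      by apply: eq_bigr => i _; rewrite resE.
    rewrite prodrXr -exprD; congr (_ ^+ _).
    rewrite -degm mdegE big_lift_max /=.
    rewrite (eq_bigr _ (fun i _ => divn_eq (m (lift u i)) p)) big_split /=.
    rewrite (eq_bigr (fun i => m (lift u i) %% p)%N (fun i _ => resE m i)).
    by rewrite addnAC addnK.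
  rewrite mpolyXE_id big_lift_max /= -mulrBl mulrC; apply: in_torus_idealM.
  by apply: in_torus_ideal_prod => i; apply: in_torus_ideal_reduce.
have sum0 : \sum_(m <- msupp F) F@_m *: M (res m) = 0.
  (* Monomials with the same residue restrict to the same character of the torus, so their
     coefficients add up to 0. *)
  rewrite (partition_big res predT) //= big1 // => r _.
  rewrite (eq_bigr (fun m => F@_m *: M r)) => [|m /eqP -> //].
  rewrite -scaler_suml.
  have vanish (a : 'I_s -> K) : (forall i, a i != 0) ->
      \sum_(m <- msupp F) F@_m * \prod_i a i ^+ m (lift u i) = 0.
    move=> a0; rewrite -[RHS](F0 a a0) mevalE; apply: eq_bigr => m _.
    rewrite big_lift_max /= point_max expr1n mulr1; congr (_ * _).
    by apply: eq_bigr => i _; rewrite point_lift.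
  have := sum_characters_eq0 vanish (fun i => r i : nat).
  rewrite (eq_bigl (fun m => res m == r)) => [-> | m]; first by rewrite scale0r.
  apply/forallP/eqP => [h | <- i]; last by rewrite resE modn_mod.
  apply/ffunP => i; apply: val_inj; rewrite /= resE.
  by move: (h i); rewrite [(r i %% p)%N]modn_small // => /eqP.
have -> : F = \sum_(m <- msupp F) F@_m *: ('X_[m] - M (res m)).
  under eq_bigr do rewrite scalerBr.
  by rewrite big_split /= sumrN sum0 subr0 -mpolyE.
rewrite big_seq; apply: (big_ind in_torus_ideal).
- exact: in_torus_ideal0.
- by move=> A B; apply: in_torus_idealD.
- by move=> m mF; rewrite -mul_mpolyC; apply: in_torus_idealM; apply: redM.
Qed.

Lemma covers_torus_complete_intersection :
  covers_torus -> complete_intersection (vanishing_ideal (@setY K n s f)).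
Proof.
move=> cov; exists torus_gen; split=> [i | F].
  by exists p; apply: torus_gen_homog.
split=> [|/ideal_gen_famP [c ->]].
  move=> hF; apply/ideal_gen_famP; apply: ideal_gen_sub hF.
  move=> {}F [[d hF] /(vanishing_on_setY hF) F0].
  apply: (in_torus_ideal_vanishing hF) => y /cov [x x0 xy].
  rewrite -[RHS](F0 x x0); apply: meval_eq => k.
  by rewrite /point; case: unlift.
exists s, c, torus_gen; split=> // i; split.
  by exists p; apply: torus_gen_homog.
apply/(vanishing_on_setY (torus_gen_homog i)) => x x0.
exact/torus_gen_eval/edge_monomial_neq0.
Qed.

End EdgeTorus.

(** * Edge deletion, cycles, and leaves of forests *)

Section GraphCycles.

Variable V : finType.
Implicit Types (G : sgraph V) (C : {set {set V}}) (S : {set V}).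

Definition del_adj G S : rel V := fun a b => adj G a b && ([set a; b] != S).

Lemma del_adj_sym G S : ssrbool.symmetric (del_adj G S).
Proof. by move=> a b; rewrite /del_adj adj_sym setUC. Qed.

Lemma del_adj_irrefl G S : irreflexive (del_adj G S).
Proof. by move=> a; rewrite /del_adj adj_irrefl. Qed.

Definition del_edge G S : sgraph V :=
  SGraph (del_adj_sym G S) (del_adj_irrefl G S).

Lemma is_cycle_del_edge G S C :
  is_cycle (del_edge G S) C <-> is_cycle G C /\ S \notin C.
Proof.
split=> [[p [/andP [cyc up] sz ->]] | [[p [/andP [cyc up] sz ->]] SC]].
  split.
    exists p; split=> //; rewrite /ucycle up andbT.
    by apply: (sub_cycle _ cyc) => a b /andP [].
  apply/imsetP => -[a ap eS].
  by have := next_cycle cyc ap; rewrite /= /del_adj -eS eqxx andbF.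
exists p; split=> //; rewrite /ucycle up andbT.
apply: cycle_from_next => // a ap; rewrite /= /del_adj (next_cycle cyc ap) /=.
by apply: contraNneq SC => <-; apply/imsetP; exists a.
Qed.

Lemma rot_to_next (p : seq V) (z : V) :
  uniq p -> 2 < size p -> z \in p ->
  exists i w t r, rot i p = [:: z, w, t & r] /\ next p z = w /\ next p w = t.
Proof.
move=> up sz zp; have [i q rp] := rot_to zp.
have := sz; have := up; rewrite -(size_rot i) -(rot_uniq i) rp.
case: q rp => [//|w [//|t r]] rp /= ur _; exists i, w, t, r; split=> //.
rewrite -(next_rot i up z) -(next_rot i up w) rp /= eqxx.
split=> //; case: eqP ur => [->|_ _]; first by rewrite inE eqxx.
by rewrite eqxx.
Qed.

Lemma next_next_neq (p : seq V) (z : V) :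
  uniq p -> 2 < size p -> z \in p -> next p (next p z) != z.
Proof.
move=> up sz zp; have [i [w [t [r [rp [-> ->]]]]]] := rot_to_next up sz zp.
have := up; rewrite -(rot_uniq i) rp /= !inE !negb_or => /andP [/and3P [_ zt _] _].
by rewrite eq_sym.
Qed.

(** Two vertices giving the same edge would each follow the other, which a cycle of length above 2
    excludes. *)
Lemma card_cycle_edges (p : seq V) :
  uniq p -> 2 < size p ->
  #|[set [set z; next p z] | z in p]| = size p.
Proof.
move=> up sz; rewrite card_in_imset; first exact/card_uniqP.
move=> x y xp yp /= e; apply/eqP; apply: contraT => xy.
have := next_next_neq up sz xp.
have := set21 x (next p x); have := set21 y (next p y).
rewrite e -{1}e !inE (negbTE xy) eq_sym (negbTE xy) /= => /eqP <- /eqP <-.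
by rewrite eqxx.
Qed.

(** Opening the cycle at [S]: the other edges form a path from w back to z, whose length has parity
    opposite to that of the cycle. *)
Lemma cycle_edge_path G C S :
  is_cycle G C -> S \in C ->
  exists z w r, [/\ adj G z w, S = [set z; w], #|C| = (size r).+1,
                    last w r = z & path (adj (del_edge G S)) w r].
Proof.
move=> [p [/andP [cyc up] sz ->]] /imsetP [z zp ->].
have [i [w [t [r [rp [nz _]]]]]] := rot_to_next up sz zp.
have szp : size p = (size r).+3 by rewrite -(size_rot i) rp.
have := up; rewrite -(rot_uniq i) rp => ur.
have := cyc; rewrite -(rot_cycle i) rp /= => /and3P [zw wt tr].
exists z, w, (t :: rcons r z); rewrite nz card_cycle_edges // szp /= size_rcons.
rewrite last_rcons; split=> //; move: ur => /=; rewrite !inE !negb_or.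
case/and4P=> /and3P [zNw zNt zNr] /andP [wNt wNr] tNr _.
rewrite /del_adj wt /=; apply/andP; split.
  apply/eqP => /setP /(_ t); rewrite !inE eqxx orbT => /esym /orP [] /eqP e.
    by rewrite e eqxx in zNt.
  by rewrite e eqxx in wNt.
(* From t on, the path never meets w again, so it cannot use the edge zw. *)
apply: (@sub_in_path _ (fun v => v != w) (adj G)) tr.
  move=> a b /= aw bw; rewrite !unfold_in /= in aw bw * => -> /=.
  apply/eqP => /setP /(_ w); rewrite !inE eqxx orbT eq_sym (negbTE aw).
  by rewrite eq_sym (negbTE bw).
rewrite /= all_rcons /= eq_sym wNt zNw; apply/allP => v vr.
by apply: contraNneq wNr => <-.
Qed.

Lemma cycle_nonempty G C : is_cycle G C -> exists S, S \in C.
Proof.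
move=> [[|z p] [_ sz ->]] //; exists [set z; next (z :: p) z].
by apply/imsetP; exists z; rewrite ?mem_head.
Qed.

(** A walk through [S] can be rerouted along the rest of the cycle. *)
Lemma connected_del_cycle_edge G C S :
  connected_graph G -> is_cycle G C -> S \in C ->
  connected_graph (del_edge G S).
Proof.
move=> [V0 conn] cC SC; split=> // x y.
have [z [w [r [zw eS _ lr pr]]]] := cycle_edge_path cC SC.
have wz : connect (adj (del_edge G S)) w z by apply/connectP; exists r.
apply: connect_sub (conn x y) => a b ab.
have [e | ne] := eqVneq [set a; b] S; last by rewrite connect1 //= /del_adj ab.
have zw' : connect (adj (del_edge G S)) z w.
  by rewrite (sym_connect_sym (@adj_sym _ (del_edge G S))).
have := set21 a b; have := set22 a b; rewrite e {1 2}eS !inE.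
case/orP=> /eqP eb; case/orP=> /eqP ea; rewrite ea eb // connect0.
Qed.

(** Without a leaf, any path can be prolonged at its front: a neighbour already on the path would
    close a cycle. Paths would then have more vertices than [V]. *)
Lemma acyclic_leaf G :
  (forall C, ~ is_cycle G C) -> (exists a b, adj G a b) ->
  exists v w, adj G v w /\ forall w', adj G v w' -> w' = w.
Proof.
move=> acyc [a0 [b0 ab0]].
have [/existsP [v /existsP [w /andP [vw /forallP h]]] | noleaf] :=
    boolP [exists v, exists w, adj G v w && [forall w', adj G v w' ==> (w' == w)]].
  by exists v, w; split=> // w' vw'; apply/eqP; apply: (implyP (h w')).
have ext v w : adj G v w -> exists2 w', adj G v w' & w' != w.
  move=> vw; have := noleaf; rewrite negb_exists => /forallP /(_ v).
  rewrite negb_exists => /forallP /(_ w); rewrite vw /= negb_forall.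
  by case/existsP=> w'; rewrite negb_imply => /andP [? ?]; exists w'.
have long k : exists x y p,
    [/\ path (adj G) x (y :: p), uniq [:: x, y & p] & size p = k].
  elim: k => [|k [x [y [p [xyp ux szp]]]]].
    exists a0, b0, [::]; split; rewrite //= ?ab0 // inE andbT.
    by apply: contraTneq ab0 => ->; rewrite adj_irrefl.
  have [/= xy yp] := andP xyp; have [w xw wy] := ext _ _ xy.
  have wx : w != x by apply: contraTneq xw => ->; rewrite adj_irrefl.
  have [wp | wNp] := boolP (w \in p); last first.
    exists w, x, (y :: p); split; rewrite //= ?szp //.
      by rewrite adj_sym xw.
    by move: ux => /= ->; rewrite !inE !negb_or wx wy wNp.
  (* The segment x, y, ..., w closes up through the edge wx; as w differs from y, it has at least
     three vertices. *)
  case/splitPr: wp ux xyp => p1 p2 ux xyp.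
  have [] := acyc [set [set z; next [:: x, y & rcons p1 w] z]
                  | z in [:: x, y & rcons p1 w]].
  exists [:: x, y & rcons p1 w]; split=> //; last by rewrite /= size_rcons.
  apply/andP; split.
    move: xyp; rewrite -cat_rcons -cat_cons cat_path => /andP [h _].
    by rewrite /= rcons_path; move: h => /= /andP [-> ->]; rewrite last_rcons adj_sym xw.
  by move: ux; rewrite -cat_rcons -!cat_cons cat_uniq => /andP [].
have [x [y [p [_ /card_uniqP up szp]]]] := long #|V|.
have := max_card (mem [:: x, y & p]).
by rewrite up /= szp ltnNge leqnSn.
Qed.

Lemma card_adj_del_edge G a b :
  adj G a b ->
  #|[pred z : V * V | adj (del_edge G [set a; b]) z.1 z.2]|
  < #|[pred z : V * V | adj G z.1 z.2]|.
Proof.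
move=> ab; apply: proper_card; apply/properP; split.
  by apply/subsetP => z; rewrite !inE => /andP [].
by exists (a, b); rewrite !inE //= /del_adj eqxx andbF.
Qed.

(** Cut off the edge at a leaf, solve the rest by induction, and choose the value at the leaf last.
    Stated generally to serve both edge values and 2-colourings. *)
Lemma forest_constraints (T : Type) (D : T -> Prop) (P : V -> V -> T -> T -> Prop) G :
  (exists t, D t) ->
  (forall u v a b, P u v a b -> P v u b a) ->
  (forall u v a, D a -> exists2 b, D b & P u v a b) ->
  (forall C, ~ is_cycle G C) ->
  exists2 x : V -> T, (forall v, D (x v))
    & forall u v, adj G u v -> P u v (x u) (x v).
Proof.
move=> [t Dt] Psym Pext.
have [k] := ubnP #|[pred z : V * V | adj G z.1 z.2]|.
elim: k G => // k IH G ltk acyc.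
have [/existsP [a /existsP [b ab]] | noedge] := boolP [exists a, exists b, adj G a b];
    last first.
  exists (fun=> t) => // u v uv; case/negP: noedge.
  by apply/existsP; exists u; apply/existsP; exists v.
have [|v [w [vw leaf]]] := acyclic_leaf acyc; first by exists a, b.
have [||x Dx xP] := IH (del_edge G [set v; w]).
- exact: leq_trans (card_adj_del_edge vw) ltk.
- by move=> C /is_cycle_del_edge [/acyc].
have wv : w != v by apply: contraTneq vw => ->; rewrite adj_irrefl.
have [c Dc Pc] := Pext w v (x w) (Dx w).
exists (fun u => if u == v then c else x u) => [u | u u' uu'].
  by case: ifP.
case: (eqVneq u v) uu' => [-> vu' | uv].
  rewrite (leaf _ vu') (negbTE wv); exact: Psym.
case: (eqVneq u' v) => [-> uv' | u'v uu'].
  by have -> : u = w by apply: leaf; rewrite adj_sym.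
apply: xP; rewrite /= /del_adj uu' /=; apply/eqP => /setP /(_ v).
by rewrite !inE eqxx eq_sym (negbTE uv) eq_sym (negbTE u'v).
Qed.

End GraphCycles.

(** * Prescribing the products of vertex values along edges *)

Section EdgeValues.

Import GRing.Theory.
Local Open Scope ring_scope.

Variables (V : finType) (K : finFieldType).
Implicit Types (G : sgraph V) (C : {set {set V}}).

(** The values are indexed by vertex sets and not by an enumeration of edges, so the same [Y] serves
    [G] and its subgraphs. *)
Definition edge_surjective G : Prop :=
  forall Y : {set V} -> K, (forall S, Y S != 0) ->
  exists2 x : V -> K, (forall v, x v != 0)
    & forall a b, adj G a b -> x a * x b = Y [set a; b].

Lemma forest_edge_surjective G :
  (forall C, ~ is_cycle G C) -> edge_surjective G.
Proof.
move=> acyc Y Y0.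
apply: (@forest_constraints _ _ (fun c : K => c != 0)
          (fun u v a b => a * b = Y [set u; v])) => //.
- by exists 1; apply: oner_neq0.
- by move=> u v a b; rewrite mulrC setUC.
- move=> u v a a0; exists (Y [set u; v] / a); last by rewrite mulrC divfK.
  by rewrite mulf_neq0 ?invr_eq0.
Qed.

Lemma forest_bipartite G :
  (forall C, ~ is_cycle G C) ->
  exists c : V -> bool, forall a b, adj G a b -> c b = ~~ c a.
Proof.
move=> acyc.
have [] := @forest_constraints _ bool (fun _ => True) (fun _ _ a b => b = ~~ a) G.
- by exists true.
- by move=> _ _ a b ->; rewrite negbK.
- by move=> _ _ a _; exists (~~ a).
- by [].
- by move=> c _ h; exists c.
Qed.

Lemma bipartite_path (e : rel V) (c : V -> bool) a r :
  (forall a b, e a b -> c b = ~~ c a) ->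
  path e a r -> c (last a r) = odd (size r) (+) c a.
Proof.
move=> hc; elim: r a => //= b r IH a /andP [ab br].
by rewrite (IH _ br) (hc _ _ ab) addbN addNb.
Qed.

Lemma inverting_path (e : rel V) (x : V -> K) a r :
  (forall a b, e a b -> x b = (x a)^-1) ->
  path e a r -> x (last a r) = if odd (size r) then (x a)^-1 else x a.
Proof.
move=> hx; elim: r a => //= b r IH a /andP [ab br].
by rewrite (IH _ br) (hx _ _ ab); case: odd; rewrite /= ?invrK.
Qed.

Lemma mulf_eq1_inv (a b : K) : a != 0 -> a * b = 1 -> b = a^-1.
Proof. by move=> a0 ab; apply: (mulfI a0); rewrite ab divff. Qed.

Lemma even_card_sqrt : ~~ odd #|K| -> forall a : K, exists b, b ^+ 2 = a.
Proof.
move=> ev a; exists (a ^+ #|K|./2).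
by rewrite -exprM muln2 even_halfK // expf_card.
Qed.

(** A choice of roots is injective, hence bijective on the finite [K], so squaring is injective and
    -1 = 1. An odd q would then equal 1 in [K], whereas it is 0. *)
Lemma sqrt_even_card : (forall a : K, exists b, b ^+ 2 = a) -> ~~ odd #|K|.
Proof.
move=> /fin_all_exists [t tK]; apply/negP => oddK.
have t_inj : injective t by apply: (can_inj (g := fun b => b ^+ 2)).
have sq_inj : injective (fun b : K => b ^+ 2).
  by apply: (bij_inj (bij_can_bij (injF_bij t_inj) tK)).
have e : -1 = 1 :> K by apply: sq_inj; rewrite sqrrN.
have := natr_card_finField K; rewrite -[#|K|]odd_double_half oddK natrD.
rewrite -mul2n natrM (_ : 2%:R = 0) ?mul0r ?addr0; last first.
  by rewrite mulr2n -{1}e addNr.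
by move/eqP; rewrite oner_eq0.
Qed.

(* Removing an edge zw of the odd cycle leaves a forest. A solution on it can be
   twisted by c or 1/c according to a 2-colouring; as z and w have the same
   colour, the twist multiplies the value at zw by c^2 or c^-2. *)
Lemma odd_unicyclic_edge_surjective G :
  unicyclic G -> (forall C, is_cycle G C -> odd #|C|) -> ~~ odd #|K| ->
  edge_surjective G.
Proof.
move=> [C [cC uniqC]] oddC evenK Y Y0.
have [S SC] := cycle_nonempty cC.
have acyc C' : ~ is_cycle (del_edge G S) C'.
  by move=> /is_cycle_del_edge [/uniqC <-]; rewrite SC.
have [z [w [r [zw eS szC lr pr]]]] := cycle_edge_path cC SC.
have [x x0 hx] := forest_edge_surjective acyc Y0.
have [col hcol] := forest_bipartite acyc.
have colz : col z = col w.
  have := bipartite_path hcol pr; rewrite lr.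
  by have := oddC _ cC; rewrite szC /= => /negbTE ->.
(* c^2 is the factor by which the forest solution misses the prescribed value at zw. *)
have [c hc] := even_card_sqrt evenK (Y [set z; w] / (x z * x w)).
have c0 : c != 0.
  by rewrite -sqrf_eq0 hc !mulf_neq0 ?invr_eq0 ?mulf_neq0.
pose t v := if col v == col z then c else c^-1.
exists (fun v => t v * x v) => [v | a b ab].
  by rewrite mulf_neq0 // /t; case: ifP => _; rewrite ?invr_eq0.
have [eab | ne] := eqVneq [set a; b] S; last first.
  have ab' : adj (del_edge G S) a b by rewrite /= /del_adj ab.
  rewrite mulrACA hx // /t (hcol _ _ ab').
  by case: (col a) (col z) => [] []; rewrite /= ?divff ?mulVf ?mul1r.
have [xab tab] : x a * x b = x z * x w /\ t a * t b = c ^+ 2.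
  have tz : t z = c by rewrite /t eqxx.
  have tw : t w = c by rewrite /t colz eqxx.
  have nab : a != b by apply: contraTneq ab => ->; rewrite adj_irrefl.
  have := set21 a b; have := set22 a b; rewrite eab eS !inE.
  case/orP=> /eqP eb; case/orP=> /eqP ea; move: nab; rewrite ea eb ?eqxx // => _.
    by rewrite mulrC tz tw.
  by rewrite tz tw.
by rewrite mulrACA xab tab hc eab eS divfK // mulf_neq0.
Qed.

Lemma exists_neq01 : #|K| <> 2 -> exists2 c : K, c != 0 & c != 1.
Proof.
move=> K2.
have [/existsP [c /andP [? ?]] | /existsPn h] :=
  boolP [exists c : K, (c != 0) && (c != 1)]; first by exists c.
case: K2; transitivity #|pred2 (0 : K) 1|; last by rewrite card2 eq_sym oner_neq0.
by apply: eq_card => c; have := h c; rewrite negb_and !negbK !inE.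
Qed.

(* Put the value c on one edge of the cycle and 1 elsewhere: going around the
   rest of the cycle inverts the vertex values at each step. *)
Lemma edge_surjective_cycle G C (c : K) :
  edge_surjective G -> is_cycle G C -> c != 0 ->
  exists b : K, c = if odd #|C| then b ^+ 2 else 1.
Proof.
move=> surj cC c0; have [S SC] := cycle_nonempty cC.
have [z [w [r [zw eS szC lr pr]]]] := cycle_edge_path cC SC.
have [|x x0 hx] := surj (fun T => if T == S then c else 1).
  by move=> T; case: ifP => _ //; apply: oner_neq0.
have hinv a b : adj (del_edge G S) a b -> x b = (x a)^-1.
  by case/andP=> ab ne; apply: mulf_eq1_inv => //; rewrite hx // (negbTE ne).
have xzw : x z * x w = c by rewrite hx // -eS eqxx.
exists (x w); have := inverting_path hinv pr; rewrite lr szC /= -xzw => ->.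
by case: odd; rewrite /= ?mulVf ?expr2.
Qed.

(** A value c other than 0 and 1, available as q is not 2, excludes even length; odd length then
    makes every element a square. *)
Lemma edge_surjective_odd_cycle G C :
  #|K| <> 2 -> edge_surjective G -> is_cycle G C -> odd #|C| && ~~ odd #|K|.
Proof.
move=> K2 surj cC; have [c c0 c1] := exists_neq01 K2.
have oddC : odd #|C|.
  have [b cE] := edge_surjective_cycle surj cC c0; apply: contraNT c1 => ev.
  by rewrite cE (negbTE ev).
rewrite oddC /=; apply: sqrt_even_card => a.
have [-> | a0] := eqVneq a 0; first by exists 0; rewrite expr2 mul0r.
by have [b ->] := edge_surjective_cycle surj cC a0; exists b; rewrite oddC.
Qed.

(* Two edges whose removal keeps G connected cannot carry independent values:
   all other values being 1, x is determined by its value at one vertex, which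
   leaves q - 1 solutions for (q - 1)^2 pairs of values. *)
Lemma edge_surjective_cycle_sub G C C' :
  #|K| <> 2 -> connected_graph G -> edge_surjective G ->
  is_cycle G C -> is_cycle G C' -> C \subset C'.
Proof.
move=> K2 conn surj cC cC'; apply/subsetP => S SC; apply: contraT => SC'.
have cC1 : is_cycle (del_edge G S) C' by apply/is_cycle_del_edge.
have [S' S'C'] := cycle_nonempty cC1.
have conn1 := connected_del_cycle_edge conn cC SC.
have [/card_gt0P [v0 _] conn2] := connected_del_cycle_edge conn1 cC1 S'C'.
have SS' : S' != S by apply: contraNneq SC' => <-.
have [z [w [_ [zw eS _ _ _]]]] := cycle_edge_path cC SC.
have [z' [w' [_ [zw' eS' _ _ _]]]] := cycle_edge_path cC' S'C'.
pose good (ab : K * K) (x : {ffun V -> K}) := [&& [forall v, x v != 0],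
  x z * x w == ab.1, x z' * x w' == ab.2 &
  [forall a, forall b, adj (del_edge (del_edge G S) S') a b ==> (x a * x b == 1)]].
(* Stated for all pairs, with a dummy labelling when an entry is 0, so that a choice function [X]
   can be extracted. *)
have ex ab : exists x, (ab.1 != 0) && (ab.2 != 0) -> good ab x.
  have [/andP [a0 b0] | _] := boolP ((ab.1 != 0) && (ab.2 != 0)); last first.
    by exists [ffun=> 1].
  have [|x x0 hx] := surj (fun T => if T == S then ab.1 else
                                    if T == S' then ab.2 else 1).
    by move=> T; case: ifP => // _; case: ifP => // _; apply: oner_neq0.
  exists [ffun v => x v] => _; apply/and4P; split.
  - by apply/forallP => v; rewrite ffunE.
  - by rewrite !ffunE hx // -eS eqxx.
  - by rewrite !ffunE hx // -eS' (negbTE SS') eqxx.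
  - apply/forallP => a; apply/forallP => b; apply/implyP.
    move=> /andP [/andP [ab1 n1] n2].
    by rewrite !ffunE hx // (negbTE n1) (negbTE n2).
have [X hX] := fin_all_exists ex.
have determined p1 p2 x1 x2 : good p1 x1 -> good p2 x2 ->
    x1 v0 = x2 v0 -> x1 =1 x2.
  move=> /and4P [/forallP n1 _ _ /forallP e1] /and4P [/forallP n2 _ _ /forallP e2].
  move=> ev v; have /connectP [r pr ->] := conn2 v0 v.
  have inv (x : {ffun V -> K}) : (forall v, x v != 0) ->
      (forall a, [forall b, adj (del_edge (del_edge G S) S') a b ==>
         (x a * x b == 1)]) ->
      forall a b, adj (del_edge (del_edge G S) S') a b -> x b = (x a)^-1.
    move=> nx ex' a b ab; apply: mulf_eq1_inv => //; apply/eqP.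
    by have /forallP /(_ b) /implyP := ex' a; apply.
  rewrite (inverting_path (inv x1 n1 e1) pr).
  by rewrite (inverting_path (inv x2 n2 e2) pr) ev.
pose nz1 := [pred c : K | c != 0].
pose nz := [set ab : K * K | (ab.1 != 0) && (ab.2 != 0)].
have : (#|[set X ab v0 | ab in nz]| <= #|nz1|)%N.
  apply: subset_leq_card; apply/subsetP => c /imsetP [ab].
  by rewrite inE => /hX /and4P [/forallP n _ _ _] ->; rewrite inE.
rewrite card_in_imset; last first.
  move=> p1 p2; rewrite !inE => /hX g1 /hX g2 e.
  have E := determined _ _ _ _ g1 g2 e.
  case/and4P: g1 => _ /eqP a1 /eqP b1 _; case/and4P: g2 => _ /eqP a2 /eqP b2 _.
  by rewrite [p1]surjective_pairing [p2]surjective_pairing -a1 -b1 -a2 -b2 !E.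
have -> : #|nz| = (#|nz1| * #|nz1|)%N.
  by rewrite -cardX; apply: eq_card => ab; rewrite !inE.
(* The inequality (q - 1)^2 <= q - 1 contradicts q > 2. *)
rewrite card_nonzero -{3}[#|K|.-1]muln1 leq_pmul2l ?card_finField_pred_gt0 //.
have := finNzRing_gt1 K; case: #|K| K2 => [|[|[|k]]] //.
Qed.

Lemma edge_surjectiveP G :
  #|K| <> 2 -> connected_graph G ->
  edge_surjective G <->
  (is_tree G \/
   [/\ unicyclic G, (forall C, is_cycle G C -> odd #|C|) & ~~ odd #|K|]).
Proof.
move=> K2 conn; split=> [surj | [[_ /forest_edge_surjective //] | []]]; last first.
  exact: odd_unicyclic_edge_surjective.
have [[C cC] | acyc] := Classical_Prop.classic (exists C, is_cycle G C).
  right; split.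
  - exists C; split=> // C' cC'; apply/eqP; rewrite eqEsubset.
    by rewrite !(edge_surjective_cycle_sub K2 conn surj).
  - by move=> C' /(edge_surjective_odd_cycle K2 surj) /andP [].
  - by have /andP [] := edge_surjective_odd_cycle K2 surj cC.
by left; split=> // C cC; apply: acyc; exists C.
Qed.

End EdgeValues.

(** * From the enumerated edges to the graph *)

Section EdgesOfGraph.

Import GRing.Theory.
Local Open Scope ring_scope.

Variables (K : finFieldType) (n s : nat) (G : sgraph 'I_n).
Variable f : 'I_s -> {set 'I_n}.
Hypothesis f_inj : injective f.
Hypothesis f_edges : [set f i | i : 'I_s] = edges G.

Lemma edge_indexP i : exists a b, adj G a b /\ f i = [set a; b].
Proof.
have : f i \in edges G by rewrite -f_edges; apply/imsetP; exists i.
by case/imsetP=> -[a b] ab ->; exists a, b; rewrite inE in ab.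
Qed.

Lemma adj_index a b : adj G a b -> exists i, f i = [set a; b].
Proof.
move=> ab; have : [set a; b] \in edges G by apply/imsetP; exists (a, b); rewrite ?inE.
by rewrite -f_edges => /imsetP [i _ ->]; exists i.
Qed.

Lemma edge_monomial_adj (x : 'I_n -> K) i a b :
  adj G a b -> f i = [set a; b] -> edge_monomial f x i = x a * x b.
Proof.
move=> ab fi; have ba : b != a by apply: contraTneq ab => ->; rewrite adj_irrefl.
rewrite /edge_monomial /char_vec fi (bigD1 a) //= (bigD1 b) //= !inE !eqxx orbT.
rewrite !expr1 big1 ?mulr1 // => j /andP [ja jb].
by rewrite !inE (negbTE ja) (negbTE jb) expr0.
Qed.

Lemma covers_torus_edge_surjective : covers_torus K f <-> edge_surjective K G.
Proof.
split=> [cov Y Y0 | surj y y0].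
  have [x x0 hx] := cov (Y \o f) (fun i => Y0 (f i)).
  exists x => // a b ab; have [i fi] := adj_index ab.
  by rewrite -(edge_monomial_adj x ab fi) hx /= fi.
(* Injectivity of [f] makes the picked index the right one; the default 1 keeps [Y] nonzero on sets
   that are not edges. *)
pose Y S := if [pick i | f i == S] is Some i then y i else 1.
have [|x x0 hx] := surj Y.
  by move=> S; rewrite /Y; case: pickP => // _; apply: oner_neq0.
exists x => // i; have [a [b [ab fi]]] := edge_indexP i.
rewrite (edge_monomial_adj x ab fi) hx // -fi /Y.
by case: pickP => [j /eqP /f_inj -> // | /(_ i)]; rewrite eqxx.
Qed.

Lemma edge_nonempty i : f i != set0.
Proof.
have [a [b [_ ->]]] := edge_indexP i.
by apply/set0Pn; exists a; rewrite set21.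
Qed.

End EdgesOfGraph.

Theorem theorem4p10 (K : finFieldType) (q : nat) (hq : #|K| = q) (hq2 : q <> 2)
  (n s : nat) (hs : 1 <= s) (G : sgraph 'I_n) (hG : connected_graph G)
  (f : 'I_s -> {set 'I_n}) (f_inj : injective f)
  (f_edges : [set f i | i : 'I_s] = edges G) :
  complete_intersection (vanishing_ideal (@setY K n s f)) <->
  (is_tree G \/
   [/\ unicyclic G, (forall C, is_cycle G C -> odd #|C|) & ~~ odd q]).
Proof.
subst q; have f_nonempty := edge_nonempty f_edges.
apply: iff_trans (edge_surjectiveP hq2 hG).
apply: iff_trans (covers_torus_edge_surjective K f_inj f_edges).
split; first exact: complete_intersection_covers_torus.
exact: covers_torus_complete_intersection.
Qed.
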